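(* Let $d\geq 1$ and let $\sigma$ be a sign pattern of length $d+1$ (beginning with $+$). If $\sigma$ is of type 1, then $\sigma$ is canonical.
   Context: All polynomials are real, univariate, monic, with all coefficients nonvanishing. Such a polynomial is a hyperbolic polynomial (HP) if all its roots are real. A sign pattern (SP) of length $d+1$ is a sequence of $d+1$ signs $+$ or $-$ beginning with $+$. The SP of $P=\sum_{j=0}^d a_jx^j$ ($a_d=1$, all $a_j\in\mathbb{R}\setminus\{0\}$) is $\sigma(P)=(+,\mathrm{sgn}(a_{d-1}),\ldots,\mathrm{sgn}(a_0))$; we say that $P$ realizes $\sigma(P)$. By Descartes' rule of signs, an HP has exactly as many positive (resp. negative) roots, counted with multiplicity, as there are sign changes (resp. sign preservations) between consecutive signs of $\sigma(P)$. Change-preservation pattern (CPP): to an SP of length $d+1$ one associates the word of length $d$ in the letters $c,p$ whose $j$-th letter ($1\le j\le d$) is $p$ if the signs in positions $j$ and $j+1$ of the SP are equal and $c$ if they are different. Canonical order: read the CPP of $\sigma$ from right to left and replace each $p$ by $N$ and each $c$ by $P$, obtaining a word $(w_1,\ldots,w_d)$. An HP realizing $\sigma$ whose roots have pairwise distinct moduli $0<\gamma_1<\cdots<\gamma_d$ has canonical order of the moduli of its roots if, for each $i$, the root of modulus $\gamma_i$ is positive when $w_i=P$ and negative when $w_i=N$. An SP $\sigma$ is canonical if every HP that realizes $\sigma$ and whose roots have pairwise distinct moduli has canonical order of the moduli of its roots. An SP of length $d+1$ is of type 1 if either all its even positions contain the same sign, or all its odd positions contain the same sign. *)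

(* Defs.v *)
From mathcomp Require Import all_boot all_order all_algebra.
From mathcomp Require Import reals complex.

Set Implicit Arguments.
Unset Strict Implicit.
Unset Printing Implicit Defensive.

Import Order.TTheory GRing.Theory Num.Theory.
Local Open Scope ring_scope.

(* Signs are booleans, [true] standing for + and [false] for -. *)
Definition is_sign_pattern (d : nat) (sigma : seq bool) : Prop :=
  size sigma = d.+1 /\ head false sigma = true.

(* Positions are numbered from 1, whereas [nth] counts from 0. *)
Definition type1 (sigma : seq bool) : Prop :=
  (exists s : bool, forall i : nat,
     (1 <= i <= size sigma)%N -> ~~ odd i -> nth true sigma i.-1 = s) \/
  (exists s : bool, forall i : nat,
     (1 <= i <= size sigma)%N -> odd i -> nth true sigma i.-1 = s).

Variant cp_letter := Change | Preservation.

Definition cpp (sigma : seq bool) : seq cp_letter :=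
  if sigma is s :: sigma' then
    pairmap (fun a b => if a == b then Preservation else Change) s sigma'
  else [::].

Variant pn_letter := Positive | Negative.

Definition canonical_word (sigma : seq bool) : seq pn_letter :=
  [seq (if l is Preservation then Negative else Positive) | l <- rev (cpp sigma)].

Section Polynomials.
Variable R : realType.
Implicit Types (p : {poly R}) (rs : seq R) (sigma : seq bool).

(* "All roots are real" refers to the complex roots of [p]. *)
Definition hyperbolic p : Prop :=
  [/\ p \is monic,
      forall j : nat, (j < size p)%N -> p`_j != 0 &
      forall z : R[i], root (map_poly (real_complex R) p) z -> z \is Num.real].

(* The coefficient sequence of a polynomial starts with the constant term, and
   a sign pattern with the leading one.  Only meaningful for polynomials without
   vanishing coefficients. *)
Definition sign_pattern_of p : seq bool := [seq 0 < a | a <- rev p].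

Definition realizes p sigma : Prop := sign_pattern_of p = sigma.

(* [rs] lists the roots of the monic polynomial [p], with multiplicity; the
   strictness of the order says that their moduli are pairwise distinct. *)
Definition roots_by_modulus p rs : Prop :=
  p = \prod_(r <- rs) ('X - r%:P) /\ sorted (fun x y : R => `|x| < `|y|) rs.

Definition canonical_order sigma rs : Prop :=
  forall i : nat, (i < size rs)%N ->
    match nth Negative (canonical_word sigma) i with
    | Positive => 0 < rs`_i
    | Negative => rs`_i < 0
    end.

Definition canonical sigma : Prop :=
  forall p rs, hyperbolic p -> realizes p sigma -> roots_by_modulus p rs ->
    canonical_order sigma rs.

End Polynomials.

Arguments canonical R sigma : clear implicits.

(* Main.v *)
Require Import Defs.
From mathcomp Require Import all_boot all_order all_algebra.
From mathcomp Require Import reals.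
From mathcomp Require Import separable polyrcf polyorder ring lra.

Set Implicit Arguments.
Unset Strict Implicit.
Unset Printing Implicit Defensive.

Import Order.TTheory GRing.Theory Num.Theory.
Local Open Scope ring_scope.

(** Write [p(x) = A(x) + B(x)], where [A] and [B] collect the monomials of each
    parity.  Type 1 means that all coefficients of one of them, say [A], have
    the same sign, so [A] has no zero on the positive half-line and [p] cannot
    vanish both at [x] and at [-x]: a positive and a negative root never have
    the same modulus.  The same holds for [u p + v x p'] with [u, v >= 0] not
    both zero, since its coefficients [(u + v j) p_j] have the signs of those
    of [p], except that the constant one vanishes when [u = 0].

    The roots of [p + t x p'] travel, as [t] goes from 0 to infinity, from the
    roots of [p] to those of [x p'], all moduli decreasing, and a positive root
    never meets the modulus of a negative one on the way.  So the order of the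
    moduli at the start, for [p], is the order at the end, for [x p']: the root
    of smallest modulus goes to 0, the others go to the roots of [p'], and signs
    are kept.  The pattern of [p'] is the pattern of [p] without its last sign
    and is again of type 1, so induction on the degree concludes.

    The end point of the path of a root [r] has a direct description: it is
    [crit p r], the first zero of [x p'] met when going from [r] towards 0.
    That [crit p] increases with the modulus is Rolle's theorem for two roots of
    the same sign.  For opposite signs it is [pos_crit_lt]: if the order were
    reversed, the Wronskian of [p(x)] and [p(-x)] would change sign, and a zero
    [x] of it would give a [t > 0] for which [p + t x p'] vanishes at [x] and
    [-x].  The induction itself is [root_signs], which says that the [i]-th root
    is positive exactly when the coefficients [p_i] and [p_(i+1)] have opposite
    signs. *)

(** * Roots of opposite signs *)

Section Crit.
Variable R : rcfType.
Implicit Types (p q : {poly R}) (rs : seq R) (r s x y u v : R).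

(** [p(x) + (-1)^b p(-x)] is twice the part of [p] of parity [b], a sum of terms
    of one sign when [x > 0].  The weak inequalities leave room for a vanishing
    coefficient, as the constant one of [x p']. *)
Lemma no_opposite_roots_of_parity p (b : bool) s k x :
  (forall j, odd j = b -> 0 <= s * p`_j) -> odd k = b -> 0 < s * p`_k ->
  0 < x -> p.[x] = 0 -> p.[- x] = 0 -> False.
Proof.
move=> p_ge0 kb pk_gt0 x_gt0 px0 pNx0.
pose F i := s * p`_i * x ^+ i * (1 + (-1) ^+ (b + i)).
have F_ge0 i : 0 <= F i.
  rewrite /F -signr_odd oddD oddb; have [ib|ne] := eqVneq (odd i) b.
    rewrite ib addbb; apply: mulr_ge0; last by rewrite /= expr0; lra.
    by rewrite mulr_ge0 ?p_ge0 ?exprn_ge0 ?ltW.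
  suff -> : b (+) odd i by rewrite expr1 subrr mulr0.
  by move: ne; case: (b); case: (odd i).
have sumF : \sum_(i < size p) F i = 0.
  transitivity (s * (p.[x] + (-1) ^+ b * p.[- x])); last first.
    by rewrite px0 pNx0 mulr0 addr0 mulr0.
  rewrite !horner_coef mulr_sumr -big_split mulr_sumr; apply: eq_bigr => i _ /=.
  rewrite /F exprD (exprNn x); move: ((-1) ^+ b) ((-1) ^+ i) (x ^+ i) => y z w.
  by ring.
have k_lt : (k < size p)%N.
  by rewrite ltnNge; apply/negP => /leq_sizeP/(_ k (leqnn k)) pk; rewrite pk mulr0 ltxx in pk_gt0.
have /(_ (Ordinal k_lt) isT) /eqP := psumr_eq0P (fun (i : 'I_(size p)) _ => F_ge0 i) sumF.
rewrite /F -signr_odd oddD oddb kb addbb /= expr0.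
apply/negP/lt0r_neq0; apply: mulr_gt0; last by lra.
by apply: mulr_gt0 => //; apply: exprn_gt0.
Qed.

(** * Critical points next to a positive root *)

(** [p] moves monotonically to its zero [r], so that [p] and [p'] have opposite
    signs before [r]; allowing different points [x] and [y] serves to compare
    signs at both ends of an interval, [x = c] included. *)
Lemma mul_deriv_lt0 p c r x y :
  p.[r] = 0 -> (forall z, c < z <= r -> p^`().[z] != 0) ->
  c <= x < r -> c < y <= r -> p.[x] * p^`().[y] < 0.
Proof.
move=> pr0 dp0 /andP[cx xr] /andP[cy yr].
have [z /andP[/= xz zr]] := poly_mvt p xr.
rewrite !bnd_simp in xz zr => E.
have zy : 0 < p^`().[z] * p^`().[y].
  apply: (@noroot_noivt _ _ (Num.min z y) r); rewrite ?in_itv /=.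
  - move=> w; rewrite in_itv/= => /andP[w1 w2]; apply: dp0; rewrite w2 andbT.
    by apply: lt_le_trans w1; rewrite lt_min cy (le_lt_trans cx).
  - by rewrite ge_min lexx /= ltW.
  - by rewrite ge_min lexx orbT.
rewrite pr0 sub0r in E.
rewrite -oppr_gt0 -mulNr E mulrAC mulr_gt0 ?subr_gt0//.
Qed.

(** When [p'] has no zero in the open interval from 0 to [r], the value is the
    left end 0, which is the root that [x p'] has in addition to those of [p']. *)
Definition pos_crit p r := prev_root p^`() 0 r.

Lemma pos_critP p r (c := pos_crit p r) : 0 < r -> p^`().[r] != 0 ->
  [/\ 0 <= c < r, 0 < c -> p^`().[c] = 0 &
      forall z, c < z <= r -> p^`().[z] != 0].
Proof.
move=> r_gt0 dpr; rewrite /c /pos_crit; case: prev_rootP => [dp0|y _ py|y _ ->].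
- by rewrite dp0 horner0 eqxx in dpr.
- rewrite in_itv /= => /andP[y_gt0 yr] nr; rewrite ltW//; split=> // z.
  case/andP=> yz; rewrite le_eqVlt => /predU1P[->//|zr].
  by have := nr z; rewrite in_itv /= yz zr; apply.
- rewrite (min_l (ltW r_gt0)) => nr; rewrite lexx r_gt0; split; [by []|by rewrite ltxx|move=> z].
  case/andP=> yz; rewrite le_eqVlt => /predU1P[->//|zr].
  by have := nr z; rewrite in_itv /= yz zr; apply.
Qed.

Lemma pos_crit_mono p r s : 0 < r < s -> p.[r] = 0 -> p.[s] = 0 ->
  p^`().[r] != 0 -> p^`().[s] != 0 -> pos_crit p r < pos_crit p s.
Proof.
case/andP=> r_gt0 rs pr ps dpr dps.
have [/andP[_ cr] _ _] := pos_critP r_gt0 dpr.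
have [_ _ nz] := pos_critP (lt_trans r_gt0 rs) dps.
apply: lt_trans cr _.
have [z] := poly_rolle rs (etrans pr (esym ps)).
rewrite in_itv /= => /andP[rz zs] dz; apply: lt_le_trans rz _.
by rewrite leNgt; apply/negP => cz; have := nz z; rewrite cz ltW// dz eqxx => /(_ isT).
Qed.

Lemma pos_crit_eq0 p r : 0 < r -> p.[r] = 0 -> p^`().[r] != 0 ->
  p^`().[0] != 0 -> pos_crit p r = 0 -> p.[0] * p^`().[0] < 0.
Proof.
move=> r_gt0 pr dpr dp0 c0.
have [_ _] := pos_critP r_gt0 dpr; rewrite c0 => nz.
have n1 : p.[0] * p^`().[r] < 0 by apply: (mul_deriv_lt0 pr nz); rewrite ?lexx ?r_gt0.
have n2 : 0 < p^`().[0] * p^`().[r].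
  apply: (@noroot_noivt _ _ 0 r); rewrite ?in_itv /= ?lexx ?ltW// => z.
  rewrite in_itv /= => /andP[]; rewrite le_eqVlt => /predU1P[<- _//|z0 zr].
  by apply: nz; rewrite z0.
rewrite -(@pmulr_llt0 _ (p^`().[r] ^+ 2)) ?exprn_even_gt0//.
have -> : p.[0] * p^`().[0] * p^`().[r] ^+ 2
        = (p.[0] * p^`().[r]) * (p^`().[0] * p^`().[r]) by ring.
by rewrite nmulr_rlt0.
Qed.

(** Both [p + t x p'] and [q + t x q'] are considered, at a common [t] in
    [[0, +oo]] encoded by the homogeneous coordinates [(u, v)]; the value
    [t = +oo] covers the common positive zeros of [p'] and [q']. *)
Definition never_meet p q := forall u v x, 0 <= u -> 0 <= v -> 0 < u + v -> 0 < x ->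
  u * p.[x] + v * (x * p^`().[x]) = 0 ->
  u * q.[x] + v * (x * q^`().[x]) = 0 -> False.

(** Applied to [p(x)] and [q(x) = p(-x)], this compares a positive and a negative
    root of [p].  If [e < c], with [c] and [e] the two critical points, then
    from [c] to [r] the quotient [p/p'] goes from minus infinity to 0 while
    [q/q'] stays finite and negative, so they agree at some [x], and the common
    value is [- t x] with [t > 0].  The quotients agree where the Wronskian
    vanishes. *)
Lemma pos_crit_lt p q r s : never_meet p q ->
  p.[0] = q.[0] -> p^`().[0] = - q^`().[0] -> p^`().[0] != 0 ->
  0 < r < s -> p.[r] = 0 -> q.[s] = 0 -> p^`().[r] != 0 -> q^`().[s] != 0 ->
  pos_crit p r < pos_crit q s.
Proof.
move=> ind E0 dE0 dp0 /andP[r_gt0 rs] pr qs dpr dqs.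
have s_gt0 := lt_trans r_gt0 rs.
have [] := pos_critP r_gt0 dpr; have [] := pos_critP s_gt0 dqs.
set c := pos_crit p r; set e := pos_crit q s.
move=> /andP[e_ge0 es] de nze /andP[c_ge0 cr] dc nzc.
rewrite ltNge le_eqVlt; apply/negP => /predU1P[ec|ec].
  (* Critical points may not coincide at 0 either: p and q start from the same
     value with opposite slopes, so only one of them can head for a zero. *)
  move: c_ge0; rewrite le_eqVlt => /predU1P[c0|c_gt0]; last first.
    by apply: (ind 0 1 c); rewrite ?dc// -?ec ?de ?ec//; lra.
  have p1 := pos_crit_eq0 r_gt0 pr dpr dp0 (esym c0).
  have dq0 : q^`().[0] != 0 by rewrite -oppr_eq0 -dE0.
  have p2 := pos_crit_eq0 s_gt0 qs dqs dq0 (etrans ec (esym c0)).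
  by move: p1 p2; rewrite E0 dE0 mulrN; lra.
have c_gt0 := le_lt_trans e_ge0 ec.
pose W := p * q^`() - q * p^`().
have Wc : W.[c] * W.[r] < 0.
  rewrite !hornerE dc// pr.
  have p1 : p.[c] * p^`().[r] < 0 by apply: (mul_deriv_lt0 pr nzc); rewrite ?lexx ?cr.
  have p2 : q.[r] * q^`().[c] < 0.
    apply: (mul_deriv_lt0 qs nze); first by rewrite rs ltW// (lt_trans ec).
    by rewrite ec ltW// (lt_trans cr).
  have : 0 < (p.[c] * p^`().[r]) * (q.[r] * q^`().[c]) by rewrite nmulr_rgt0.
  by lra.
have [x] := poly_ivtoo (ltW cr) Wc; rewrite in_itv /= => /andP[cx xr].
move=> /rootP; rewrite !hornerE => Wx.
have p1 : p.[x] * p^`().[x] < 0 by apply: (mul_deriv_lt0 pr nzc); rewrite ?xr ?cx ltW.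
have p2 : q.[x] * q^`().[x] < 0.
  have [ex xs] := (lt_trans ec cx, lt_trans xr rs).
  by apply: (mul_deriv_lt0 qs nze); rewrite ?ex ?xs ltW.
have x_gt0 := lt_trans c_gt0 cx.
have dpx : p^`().[x] != 0 by apply: nzc; rewrite cx ltW.
have t_gt0 : 0 < - p.[x] / (x * p^`().[x]).
  rewrite -(@pmulr_lgt0 _ (x * p^`().[x] ^+ 2)).
    have -> : - p.[x] / (x * p^`().[x]) * (x * p^`().[x] ^+ 2)
      = - (p.[x] * p^`().[x]) by field; rewrite dpx gt_eqF.
    by rewrite oppr_gt0.
  by rewrite mulr_gt0// exprn_even_gt0.
(* The parameter t is chosen to cancel p + t x p' at x. *)
apply: (ind 1 (- p.[x] / (x * p^`().[x])) x) => //.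
- exact: ltW.
- exact: addr_gt0.
- by field; rewrite dpx gt_eqF.
- have -> : 1 * q.[x] + - p.[x] / (x * p^`().[x]) * (x * q^`().[x])
     = (q.[x] * p^`().[x] - p.[x] * q^`().[x]) / p^`().[x] by field; rewrite dpx gt_eqF.
  by rewrite -opprB Wx oppr0 mul0r.
Qed.

(** * Critical points and the order of the moduli *)

Definition refl p := p \Po (- 'X).

Lemma horner_refl p x : (refl p).[x] = p.[- x].
Proof. by rewrite /refl horner_comp !hornerE. Qed.

Lemma deriv_refl p x : (refl p)^`().[x] = - p^`().[- x].
Proof. by rewrite /refl deriv_comp !derivE hornerM horner_comp !hornerE mulrN1. Qed.

Definition crit p r :=
  if 0 < r then pos_crit p r else - pos_crit (refl p) (- r).

Definition signed_parity p :=
  exists (b : bool) s, forall j, (j < size p)%N -> odd j = b -> 0 < s * p`_j.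

Lemma signed_parity_deriv p : signed_parity p -> signed_parity p^`().
Proof.
case=> b [s H]; exists (~~ b), s => j; rewrite size_deriv coef_deriv => j_lt jb.
rewrite mulrnAr pmulrn_lgt0// H /= ?jb ?negbK//.
by move: j_lt; case: (size p).
Qed.

(** The degree bound makes the chosen parity contain an index 1 or 2, hence a
    coefficient that survives in [x p'], the case [u = 0]. *)
Lemma never_meet_refl p : signed_parity p -> (2 < size p)%N ->
  never_meet p (refl p) /\ never_meet (refl p) p.
Proof.
move=> [b [s H]] p_gt2.
suff ind u v x : 0 <= u -> 0 <= v -> 0 < u + v -> 0 < x ->
  u * p.[x] + v * (x * p^`().[x]) = 0 ->
  u * (refl p).[x] + v * (x * (refl p)^`().[x]) = 0 -> False.
  by split=> u v x u0 v0 uv x0 h1 h2; apply: (ind u v x).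
move=> u0 v0 uv x0 h1; rewrite horner_refl deriv_refl mulrN -mulNr => h2.
pose q := u *: p + v *: ('X * p^`()).
have qE j : q`_j = (u + v * j%:R) * p`_j.
  rewrite !coefE; case: j => [|j] /=; first by rewrite !mulr0 !addr0.
  by rewrite -mulr_natr; ring.
have w_ge0 j : 0 <= u + v * j%:R by rewrite addr_ge0 ?mulr_ge0 ?ler0n.
apply: (@no_opposite_roots_of_parity q b s (~~ b).+1 x) => //; last 2 first.
- by rewrite !hornerE -[RHS]h1 /=; ring.
- by rewrite !hornerE -[RHS]h2 /=; ring.
- move=> j jb; rewrite qE mulrCA mulr_ge0//.
  have [/H|le] := ltnP j (size p); first by move=> /(_ jb)/ltW.
  by rewrite nth_default ?mulr0.
- by rewrite /= oddb negbK.
- rewrite qE mulrCA mulr_gt0//; last first.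
    by rewrite H /= ?oddb ?negbK//; apply: leq_trans p_gt2; case: (b).
  apply: lt_le_trans uv _; rewrite lerD2l ler_peMr// ler1n//.
Qed.

Lemma critP p r : r != 0 -> p^`().[r] != 0 -> crit p r != 0 ->
  0 < crit p r * r /\ p^`().[crit p r] = 0.
Proof.
rewrite /crit => r0 dpr; case: ifPn => [r_gt0|].
  have [/andP[c_ge0 _] dc _] := pos_critP r_gt0 dpr => c0.
  have c_gt0 : 0 < pos_crit p r by rewrite lt0r c0.
  by rewrite dc ?mulr_gt0.
rewrite -leNgt le_eqVlt (negPf r0) /= -oppr_gt0 => Nr_gt0.
have dqr : (refl p)^`().[- r] != 0 by rewrite deriv_refl opprK oppr_eq0.
have [/andP[c_ge0 _] dc _] := pos_critP Nr_gt0 dqr; rewrite oppr_eq0 => c0.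
have c_gt0 : 0 < pos_crit (refl p) (- r) by rewrite lt0r c0.
split; first by rewrite mulNr -mulrN mulr_gt0.
by have /eqP := dc c_gt0; rewrite deriv_refl oppr_eq0 => /eqP.
Qed.

Lemma crit_mono p r s : signed_parity p -> (2 < size p)%N ->
  p.[0] != 0 -> p^`().[0] != 0 -> p.[r] = 0 -> p.[s] = 0 ->
  p^`().[r] != 0 -> p^`().[s] != 0 -> `|r| < `|s| -> `|crit p r| < `|crit p s|.
Proof.
move=> sp p_gt2 p0 dp0 pr ps dpr dps.
have nz x : p.[x] = 0 -> x != 0 by move=> /eqP px; apply: contraNneq p0 => E0; rewrite -{1}E0.
have r0 := nz _ pr; have s0 := nz _ ps.
have qr : (refl p).[- r] = 0 by rewrite horner_refl opprK.
have qs : (refl p).[- s] = 0 by rewrite horner_refl opprK.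
have dqr : (refl p)^`().[- r] != 0 by rewrite deriv_refl opprK oppr_eq0.
have dqs : (refl p)^`().[- s] != 0 by rewrite deriv_refl opprK oppr_eq0.
have q0 : p.[0] = (refl p).[0] by rewrite horner_refl oppr0.
have dq0 : p^`().[0] = - (refl p)^`().[0] by rewrite deriv_refl oppr0 opprK.
have [ind1 ind2] := never_meet_refl sp p_gt2.
have neg x : x != 0 -> ~~ (0 < x) -> 0 < - x.
  by move=> x0; rewrite -leNgt le_eqVlt (negPf x0) oppr_gt0.
have ge0 q x : 0 < x -> q^`().[x] != 0 -> `|pos_crit q x| = pos_crit q x.
  by move=> x0 qx; have [/andP[/ger0_norm]] := pos_critP x0 qx.
rewrite /crit; case: ifPn => [r_gt0|/(neg _ r0) r_lt0];
  case: ifPn => [s_gt0|/(neg _ s0) s_lt0]; rewrite ?normrN ?ge0//.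
- by rewrite !gtr0_norm// => rs; apply: pos_crit_mono => //; rewrite r_gt0.
- rewrite gtr0_norm// -(normrN s) gtr0_norm// => rs.
  by apply: pos_crit_lt => //; rewrite r_gt0.
- rewrite -(normrN r) !gtr0_norm// => rs.
  apply: pos_crit_lt => //; last by rewrite r_lt0.
    by rewrite dq0 opprK.
  by rewrite -oppr_eq0 -dq0.
- rewrite -(normrN r) -(normrN s) !gtr0_norm// => rs.
  by apply: pos_crit_mono; rewrite ?r_lt0.
Qed.

(** Between 0 and such a root, [p] and [p'] keep the signs that they have at 0,
    and [p] moves towards zero; thus the sign of the root is read off the two
    coefficients of lowest degree. *)
Lemma crit_eq0 p r : r != 0 -> p.[r] = 0 -> p^`().[r] != 0 -> p^`().[0] != 0 ->
  crit p r = 0 -> r * (p.[0] * p^`().[0]) < 0.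
Proof.
rewrite /crit => r0 pr dpr dp0; case: ifPn => [r_gt0 c0|].
  by rewrite pmulr_rlt0//; apply: pos_crit_eq0 c0.
rewrite -leNgt le_eqVlt (negPf r0) /= -oppr_gt0 => Nr_gt0 /eqP.
rewrite oppr_eq0 => /eqP c0.
have := @pos_crit_eq0 (refl p) (- r); rewrite !deriv_refl !horner_refl opprK oppr0.
rewrite !oppr_eq0 => /(_ Nr_gt0 pr dpr dp0 c0).
by rewrite mulrN oppr_lt0 => h; rewrite nmulr_rlt0// -oppr_gt0.
Qed.

Lemma simple_roots p rs : size p = (size rs).+1 -> all (root p) rs -> uniq rs ->
  {in rs, forall r, p^`().[r] != 0}.
Proof.
move=> sz roots_rs u r r_rs.
have p0 : p != 0 by rewrite -size_poly_gt0 sz.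
have : separable_poly p.
  rewrite (all_roots_prod_XsubC sz) ?uniq_rootsE//.
  rewrite (eqp_separable (eqp_scale _ _)) ?lead_coef_eq0//.
  by rewrite separable_prod_XsubC.
by rewrite unlock => sep; apply: coprimep_root sep (allP roots_rs r r_rs).
Qed.

(** The images of the [d] roots of [p] under [crit p] are [d] zeros of [x p'] in
    increasing order of moduli.  As [p'] has only [d - 1] roots, 0 is among them
    and comes first; the others are all the roots of [p'], in order. *)
Lemma root_signs p rs : (forall j, (j < size p)%N -> p`_j != 0) ->
  signed_parity p -> size p = (size rs).+1 -> all (root p) rs ->
  sorted (fun x y => `|x| < `|y|) rs ->
  forall i, (i < size rs)%N -> rs`_i * (p`_i * p`_i.+1) < 0.
Proof.
have ltT : transitive (fun x y : R => `|x| < `|y|) by move=> y x z; apply: lt_trans.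
have ltI : irreflexive (fun x y : R => `|x| < `|y|) by move=> x; rewrite ltxx.
move En : (size rs) => n; elim: n p rs En => // n IH p rs En nz sp sz roots_rs srt.
have urs := sorted_uniq ltT ltI srt.
rewrite -En in sz; have simple := simple_roots sz roots_rs urs.
have p0 : p.[0] != 0 by rewrite horner_coef0 nz ?sz.
have dp0E : p^`().[0] = p`_1 by rewrite horner_coef0 coef_deriv.
have dp0 : p^`().[0] != 0 by rewrite dp0E nz// sz En.
have nzr r : r \in rs -> r != 0.
  by move=> /(allP roots_rs) pr; apply: contraNneq p0 => E0; rewrite -{1}E0.
have srtc : sorted (fun x y => `|x| < `|y|) (map (crit p) rs).
  apply: (homo_sorted_in (P := [in rs])) srt; last exact/allP.
  move=> r s r_rs s_rs /= rs_lt; apply: crit_mono => //; try exact/rootP/(allP roots_rs);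
    try exact: simple.
  have : (size [:: r; s] <= size rs)%N.
    apply: uniq_leq_size => [|x].
      by rewrite /= andbT inE; apply: contraTneq rs_lt => ->; rewrite ltxx.
    by rewrite !inE => /orP[]/eqP->.
  by rewrite sz.
case: rs => // r0 rs in En sz roots_rs srt urs simple nzr srtc *.
have r0_in : r0 \in r0 :: rs by rewrite mem_head.
move: (srtc); rewrite /= => /(order_path_min ltT) cmin.
(* Otherwise all d values of crit are distinct roots of p', of degree d - 1. *)
have c0 : crit p r0 = 0.
  apply/eqP/negPn/negP => c0.
  have dp_neq0 : p^`() != 0 by apply: contraNneq dp0 => ->; rewrite horner0.
  have := max_poly_roots dp_neq0 _ (sorted_uniq ltT ltI srtc).
  rewrite size_map size_deriv sz ltnn => no_room.
  suff /no_room : all (root p^`()) (map (crit p) (r0 :: rs)) by [].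
  apply/allP => _ /mapP[r r_in ->]; apply/rootP.
  apply: (critP (nzr _ r_in) (simple _ r_in) _).2.
  move: r_in; rewrite inE => /predU1P[->//|r_in].
  rewrite -normr_gt0; apply: le_lt_trans (normr_ge0 (crit p r0)) _.
  by apply: (allP cmin); apply: map_f.
have cnz r : r \in rs -> crit p r != 0.
  move=> r_in; rewrite -normr_gt0; have := allP cmin _ (map_f (crit p) r_in).
  by rewrite c0 normr0.
case=> [_|i /= i_lt].
  rewrite -dp0E -horner_coef0; apply: (crit_eq0 (nzr _ r0_in) _ _ dp0 c0).
    exact/rootP/(allP roots_rs).
  exact: simple.
case: En => En.
have := IH p^`() (map (crit p) rs); rewrite size_map En size_deriv sz /= En.
move=> /(_ erefl _ (signed_parity_deriv sp) erefl _ (path_sorted srtc) i i_lt) H.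
have /H/= {H} : forall j, (j < n.+1)%N -> p^`()`_j != 0.
  by move=> j j_lt; rewrite coef_deriv mulrn_eq0 /= nz// sz /= En.
have ri_in : rs`_i \in rs by rewrite mem_nth ?En.
have [ci_gt0 _] := critP (nzr (rs`_i) (mem_behead (s := r0 :: rs) ri_in))
                   (simple _ (mem_behead (s := r0 :: rs) ri_in)) (cnz _ ri_in).
move=> H; have {H} : crit p rs`_i * (p^`()`_i * p^`()`_i.+1) < 0.
  rewrite -(nth_map 0 0 (crit p)) ?En//; apply: H.
  apply/allP => _ /mapP[r r_in ->]; apply/rootP.
  have r_in' : r \in r0 :: rs by rewrite inE r_in orbT.
  exact: (critP (nzr _ r_in') (simple _ r_in') (cnz _ r_in)).2.
rewrite !coef_deriv !mulrnAl !mulrnAr !pmulrn_llt0//.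
set a := _ * p`__ => H.
have := nmulr_llt0 (crit p rs`_i * rs`_i) H; rewrite ci_gt0.
have -> : crit p rs`_i * rs`_i * (crit p rs`_i * a) = crit p rs`_i ^+ 2 * (rs`_i * a).
  by ring.
by rewrite pmulr_rlt0// exprn_even_gt0//= cnz.
Qed.

End Crit.

(** * Sign patterns *)

Section Patterns.
Variable R : realType.
Implicit Types p : {poly R}.

(** Position [i] of the pattern belongs to the coefficient of index
    [size p - i], so that parities of positions and of indices differ by that
    of [size p]. *)
Lemma type1_signed_parity p : (forall j, (j < size p)%N -> p`_j != 0) ->
  type1 (sign_pattern_of p) -> signed_parity p.
Proof.
move=> nz; rewrite /type1 /sign_pattern_of size_map size_rev.
have H (f : bool -> bool) (s : bool) :
  (forall i, (1 <= i <= size p)%N -> f (odd i) ->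
     nth true [seq 0 < a | a <- rev p] i.-1 = s) ->
  f =1 negb \/ f =1 id -> signed_parity p.
  move=> hs ff; exists (odd (size p) (+) f true), (if s then 1 else -1) => j j_lt jb.
  have := hs (size p - j)%N; rewrite subn_gt0 j_lt leq_subr oddB ?(ltnW j_lt)// jb.
  have -> : f (odd (size p) (+) (odd (size p) (+) f true)).
    by rewrite addbA addbb /=; case: ff => ff; rewrite !ff.
  have lt1 : ((size p - j).-1 < size p)%N.
    by rewrite prednK ?subn_gt0 ?leq_subr.
  move=> /(_ isT isT); rewrite (nth_map 0) ?size_rev// nth_rev//.
  rewrite prednK ?subn_gt0// subKn ?(ltnW j_lt)// => <-.
  have := nz j j_lt; rewrite neq_lt => /orP[lt0|gt0].
    by rewrite (lt_gtF lt0) mulN1r oppr_gt0.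
  by rewrite gt0 mul1r.
by case=> -[s hs]; [apply: (H negb s) => //; left|apply: (H id s) => //; right].
Qed.

(** Patterns start with the leading coefficient, and the word is read from the
    right: the two reversals cancel, and letter [i] compares coefficients [i]
    and [i + 1]. *)
Lemma nth_canonical_word p i : (i.+1 < size p)%N ->
  nth Negative (canonical_word (sign_pattern_of p)) i =
  if (0 < p`_i.+1) == (0 < p`_i) then Negative else Positive.
Proof.
move=> i_lt; rewrite /canonical_word /sign_pattern_of.
have nthE j : (j < size p)%N ->
  nth true [seq 0 < a | a <- rev p] j = (0 < p`_(size p - j.+1)).
  by move=> j_lt; rewrite (nth_map 0) ?size_rev// nth_rev.
have: size [seq 0 < a | a <- rev p] = size p by rewrite size_map size_rev.
case E : [seq 0 < a | a <- rev p] => [|s sg] /= sz; first by rewrite -sz in i_lt.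
have i_lt' : (i < size sg)%N by rewrite -ltnS sz.
have sub_lt : (size sg - i.+1 < size sg)%N.
  by rewrite ltn_subrL (leq_ltn_trans _ i_lt').
rewrite (nth_map Change) ?size_rev ?size_pairmap// nth_rev ?size_pairmap//.
rewrite (nth_pairmap true)//.
have e1 : (size sg - i.+1 < size p)%N by rewrite -sz ltnS ltnW.
have e2 : ((size sg - i.+1).+1 < size p)%N by rewrite -sz ltnS.
have := nthE _ e1; have := nthE _ e2; rewrite E /= => -> ->.
have -> : (size p - (size sg - i.+1).+1 = i.+1)%N by rewrite -sz subSS subKn.
have -> : (size p - (size sg - i.+1).+2 = i)%N.
  by rewrite -sz subSS -subSn// subSS subKn// ltnW.
by case: eqP.
Qed.

End Patterns.

Theorem theorem1 (R : realType) (d : nat) (sigma : seq bool) :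
  (1 <= d)%N -> is_sign_pattern d sigma -> type1 sigma -> canonical R sigma.
Proof.
move=> _ _ t1 p rs [_ nz _] pE [prodE srt]; rewrite -{}pE in t1 *.
have sz : size p = (size rs).+1 by rewrite prodE size_prod_XsubC.
move=> i i_lt; rewrite nth_canonical_word ?sz//.
have all_rs : all (root p) rs by apply/allP => r; rewrite prodE root_prod_XsubC.
have := root_signs nz (type1_signed_parity nz t1) sz all_rs srt i_lt.
have : p`_i != 0 by rewrite nz// sz ltnW.
have : p`_i.+1 != 0 by rewrite nz// sz.
rewrite !neq_lt => /orP[b0|b0] /orP[a0|a0].
- by rewrite (lt_gtF b0) (lt_gtF a0) /= pmulr_llt0 // nmulr_rgt0.
- by rewrite (lt_gtF b0) a0 /= nmulr_llt0 // pmulr_rlt0.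
- by rewrite b0 (lt_gtF a0) /= nmulr_llt0 // nmulr_rlt0.
- by rewrite a0 b0 /= pmulr_llt0 // mulr_gt0.
Qed.
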